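(* Consider the linear divergence-free vector field $\mathbf{a}(x)=(a_i(x))_{i=1}^3$, $a_i(x)=a_{i1}x_1+a_{i2}x_2+a_{i3}x_3$, on $\mathbb{R}^3$, with real coefficients satisfying $a_{11}+a_{22}+a_{33}=0$, $a_{12}\neq0$ and $a_{13}\neq0$. Let $$\phi(x_1,X_1,x_2)=\frac{\big(m_1(X_1-x_1-\Delta t\,a_{11}x_1)-\Delta t^2a_{31}a_{13}m_2x_1\big)x_2}{\Delta t\,a_{13}}-\frac{m_1a_{12}x_2^2}{2a_{13}}-\frac{\Delta t\,a_{32}m_2x_2^2}{2},$$ $$\Phi(x_1,X_1,X_3)=\frac{(1+\Delta t\,a_{22})\big(X_1-(1+\Delta t\,a_{11})x_1\big)X_3}{\Delta t\,a_{12}}-\frac{a_{13}(1+\Delta t\,a_{22})X_3^2}{2a_{12}}+\Delta t\,a_{21}X_1X_3+\frac{\Delta t\,a_{23}}{2}X_3^2+\frac{m_1\big(2X_1x_1-(1+\Delta t\,a_{11})x_1^2\big)}{2\Delta t^2a_{12}a_{13}},$$ where $m_1=1-\Delta t\,a_{33}+\Delta t^2a_{11}a_{22}$ and $m_2=1+\Delta t^2a_{11}a_{22}/(1-\Delta t\,a_{33})$. Then the class $S_2$ generating one-form $\lambda=\phi\,dx_1+\Phi\,dX_1$ yields a first-order volume preserving integrator for $\dot{x}=\mathbf{a}(x)$ with time step $\Delta t$.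
   Context: Class $S_2$ generating one-form: given functions $\phi(x_1,X_1,x_2)$ and $\Phi(x_1,X_1,X_3)$, the form $\lambda=\phi\,dx_1+\Phi\,dX_1$ generates the map $x=(x_1,x_2,x_3)\mapsto X=(X_1,X_2,X_3)$ defined implicitly by $$x_3=\partial_{x_2}\phi(x_1,X_1,x_2),\qquad \partial_{X_1}\phi(x_1,X_1,x_2)=\partial_{x_1}\Phi(x_1,X_1,X_3),\qquad X_2=\partial_{X_3}\Phi(x_1,X_1,X_3).$$ ''Yields a first-order volume preserving integrator for $\dot x=\mathbf{a}(x)$'' means: for all sufficiently small $\Delta t>0$ these equations determine a unique map $x\mapsto X$ on $\mathbb{R}^3$, this map preserves the volume form $dx_1\wedge dx_2\wedge dx_3$ (its Jacobian determinant is $1$), and it is consistent with $\mathbf{a}$: for every $x$, $X=x+\Delta t\,\mathbf{a}(x)+O(\Delta t^2)$ as $\Delta t\to0$. *)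

(* Defs.v *)
From HB Require Import structures.
From mathcomp Require Import all_boot all_order all_algebra.
From mathcomp Require Import all_classical all_reals all_analysis.

Set Implicit Arguments.
Unset Strict Implicit.
Unset Printing Implicit Defensive.

Import Order.TTheory GRing.Theory Num.Theory.
Import numFieldNormedType.Exports.

Local Open Scope classical_set_scope.
Local Open Scope ring_scope.

(* The mathematical indices 1, 2, 3 are the ordinals 0, 1, 2 of 'I_3. *)
Notation i1 := (0 : 'I_3).
Notation i2 := (1 : 'I_3).
Notation i3 := (2 : 'I_3).

(* The form phi(x1, X1, x2) dx1 + Phi(x1, X1, X3) dX1. *)
Record S2_one_form (R : realType) := S2OneForm {
  coef_dx1 : R -> R -> R -> R;
  coef_dX1 : R -> R -> R -> R
}.

Definition S2_equations (R : realType) (lambda : S2_one_form R)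
    (x X : 'rV[R]_3) : Prop :=
  let phi := coef_dx1 lambda in
  let Phi := coef_dX1 lambda in
  let x1 := x 0 i1 in let x2 := x 0 i2 in let x3 := x 0 i3 in
  let X1 := X 0 i1 in let X2 := X 0 i2 in let X3 := X 0 i3 in
  [/\ x3 = derive1 (fun t : R => phi x1 X1 t) x2,
      derive1 (fun t : R => phi x1 t x2) X1 = derive1 (fun t : R => Phi t X1 X3) x1 &
      X2 = derive1 (fun t : R => Phi x1 X1 t) X3].

(* For every x, f x is the one and only solution X of the equations. *)
Definition S2_generates (R : realType) (lambda : S2_one_form R)
    (f : 'rV[R]_3 -> 'rV[R]_3) : Prop :=
  forall x X : 'rV[R]_3, S2_equations lambda x X <-> X = f x.

(* [jacobian] is the transpose of the usual Jacobian matrix (it acts on row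
   vectors), which does not affect the determinant. *)
Definition volume_preserving (R : realType)
    (f : 'rV[R]_3 -> 'rV[R]_3) : Prop :=
  forall x : 'rV[R]_3, differentiable f x /\ \det (jacobian f x) = 1.

(* The family [lambda] is indexed by the time step dt. The bound on dt is
   uniform in x, whereas the constant in the O(dt^2) may depend on x. *)
Definition first_order_volume_preserving_integrator (R : realType)
    (lambda : R -> S2_one_form R) (a : 'rV[R]_3 -> 'rV[R]_3) : Prop :=
  exists f : R -> 'rV[R]_3 -> 'rV[R]_3,
    (\forall dt \near 0^'+,
       S2_generates (lambda dt) (f dt) /\ volume_preserving (f dt)) /\
    (forall x : 'rV[R]_3,
       (fun dt : R => f dt x - (x + dt *: a x))
         =O_ (0^'+) (fun dt : R => dt ^+ 2)).

Definition linear_field (R : realType) (A : 'M[R]_3) (x : 'rV[R]_3) :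
    'rV[R]_3 :=
  \row_i (A i i1 * x 0 i1 + A i i2 * x 0 i2 + A i i3 * x 0 i3).

Section GeneratingForm.
Variables (R : realType) (A : 'M[R]_3) (dt : R).

Let a11 := A i1 i1. Let a12 := A i1 i2. Let a13 := A i1 i3.
Let a21 := A i2 i1. Let a22 := A i2 i2. Let a23 := A i2 i3.
Let a31 := A i3 i1. Let a32 := A i3 i2. Let a33 := A i3 i3.

Definition m1 : R := 1 - dt * a33 + dt ^+ 2 * a11 * a22.

Definition m2 : R := 1 + dt ^+ 2 * a11 * a22 / (1 - dt * a33).

Definition phi (x1 X1 x2 : R) : R :=
  (m1 * (X1 - x1 - dt * a11 * x1) - dt ^+ 2 * a31 * a13 * m2 * x1) * x2
    / (dt * a13)
  - m1 * a12 * x2 ^+ 2 / (2 * a13)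
  - dt * a32 * m2 * x2 ^+ 2 / 2.

Definition Phi (x1 X1 X3 : R) : R :=
  (1 + dt * a22) * (X1 - (1 + dt * a11) * x1) * X3 / (dt * a12)
  - a13 * (1 + dt * a22) * X3 ^+ 2 / (2 * a12)
  + dt * a21 * X1 * X3
  + dt * a23 / 2 * X3 ^+ 2
  + m1 * (2 * X1 * x1 - (1 + dt * a11) * x1 ^+ 2)
    / (2 * dt ^+ 2 * a12 * a13).

Definition generating_form : S2_one_form R := S2OneForm phi Phi.

End GeneratingForm.

(* Main.v *)
(* Substituting the second equation into the other two, they become triangular:
     X3 = (x3 + dt m2 (a31 x1 + a32 x2)) / m1,
     X1 = (1 + dt a11) x1 + dt a12 x2 + dt a13 X3,
     X2 = (1 + dt a22) x2 + dt a21 X1 + dt a23 X3.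
   So x |-> X updates the coordinates 3, 1, 2 in turn by linear forms, and its
   determinant is the product of the diagonal coefficients 1 / m1, 1 + dt a11
   and 1 + dt a22.  This is 1 because a11 + a22 + a33 = 0 gives
   m1 = (1 + dt a11) (1 + dt a22).  Consistency holds because m1 and m2 are
   1 - dt a33 and 1 up to O(dt^2). *)
Require Import Defs.
From mathcomp Require Import all_boot all_order all_algebra.
From mathcomp Require Import all_classical all_reals all_analysis.
From mathcomp Require Import ring.

Import Order.TTheory GRing.Theory Num.Theory.
Import numFieldNormedType.Exports.

Local Open Scope classical_set_scope.
Local Open Scope ring_scope.

(** * Rows of length three and single-coordinate updates *)

Lemma sum_ord3 (V : nmodType) (F : 'I_3 -> V) :
  \sum_i F i = F i1 + F i2 + F i3.
Proof.
rewrite !big_ord_recl big_ord0 addr0 !addrA.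
by congr (F _ + F _ + F _); apply/val_inj.
Qed.

Lemma ord3P (j : 'I_3) : [\/ j = i1, j = i2 | j = i3].
Proof.
case: j => [[|[|[|//]]]] lt_j3.
- by apply: Or31; apply/val_inj.
- by apply: Or32; apply/val_inj.
- by apply: Or33; apply/val_inj.
Qed.

Lemma rV3P (R : Type) (x y : 'rV[R]_3) :
  x 0 i1 = y 0 i1 -> x 0 i2 = y 0 i2 -> x 0 i3 = y 0 i3 -> x = y.
Proof. by move=> e1 e2 e3; apply/rowP => j; case: (ord3P j) => ->. Qed.

(** Right multiplication by this matrix changes only coordinate [j] of a row vector: it models one
    stage of the integrator. *)
Definition update_mx {R : comPzRingType} {n : nat} (j : 'I_n) (c : 'rV[R]_n) :
    'M[R]_n :=
  \matrix_(i, k) if k == j then c 0 i else (i == k)%:R.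

Lemma mul_update_mx {R : comPzRingType} {n : nat} (j : 'I_n)
    (c x : 'rV[R]_n) (k : 'I_n) :
  (x *m update_mx j c) 0 k =
    if k == j then \sum_i x 0 i * c 0 i else x 0 k.
Proof.
rewrite mxE; under eq_bigr do rewrite mxE.
case: (k == j) => //; rewrite (bigD1 k) //= eqxx mulr1 big1 ?addr0 // => i.
by move=> /negPf->; rewrite mulr0.
Qed.

(** Expand along column [j]. The [(j, j)] minor is the identity; deleting another row and column [j]
    keeps row [j], which is then zero. *)
Lemma det_update_mx {R : comPzRingType} {n : nat} (j : 'I_n) (c : 'rV[R]_n) :
  \det (update_mx j c) = c 0 j.
Proof.
rewrite (expand_det_col _ j) (bigD1 j) //= mxE eqxx big1 => [|k neq_kj].
  rewrite addr0 /cofactor addnn -signr_odd odd_double mul1r.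
  rewrite (_ : row' j _ = 1%:M) ?det1 ?mulr1 //; apply/matrixP => a b.
  by rewrite !mxE eq_sym (negPf (neq_lift j b)) (inj_eq lift_inj).
have [a -> _] := unlift_some neq_kj; rewrite /cofactor (expand_det_row _ a).
rewrite big1 ?mulr0 // => b _.
by rewrite !mxE eq_sym !(negPf (neq_lift _ b)) mul0r.
Qed.

(** * Linear maps, derivatives and row-valued estimates *)

Lemma mulmxr_continuous {R : realType} {m n : nat} (M : 'M[R]_(m, n)) :
  continuous (mulmxr M : 'rV[R]_m -> 'rV[R]_n).
Proof.
rewrite (_ : (mulmxr M : _ -> _) = fun x : 'rV_m => \sum_i x 0 i *: row i M).
  apply: continuous_big => [|i _ x]; first exact: add_continuous.
  by apply: cvgZr_tmp; [exact: (nbhs_filter x) | exact: coord_continuous].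
by apply/funext => x /=; rewrite mulmx_sum_row.
Qed.

(** A continuous linear map is its own differential, so its [jacobian] is [M] at every point. *)
Lemma volume_preserving_mulmx (R : realType) (M : 'M[R]_3) :
  \det M = 1 -> volume_preserving (fun x => x *m M).
Proof.
move=> detM x; have cM := mulmxr_continuous M; split.
  exact: (linear_differentiable x cM).
rewrite /jacobian -[X in \det (lin1_mx X)]/('d (mulmxr M) x : _ -> _).
rewrite (diff_lin x cM) -[RHS]detM; congr (\det _).
by apply/row_matrixP => i; rewrite !rowE mul_rV_lin1.
Qed.

(** Serves all four derivatives in the generating equations, since [phi] and [Phi] have degree at
    most two in each variable differentiated. *)
Lemma derive1_quadratic {R : realType} (a b c t : R) :
  derive1 (fun t : R => a * t ^+ 2 + b * t + c) t = 2 * a * t + b.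
Proof.
rewrite (_ : (fun _ => _) = horner (a *: 'X^2 + b *: 'X + c%:P)); last first.
  by apply/funext => s; rewrite !hornerE.
rewrite derive1E (@derive_val _ _ _ _ _ _ _ (is_derive_poly _ t)).
by rewrite !(derivD, derivZ, derivXn, derivX, derivC) !hornerE; ring.
Qed.

Lemma eq_iff_scale {R : idomainType} (k a b c d : R) :
  k != 0 -> a - b = k * (c - d) -> (a = b) <-> (c = d).
Proof.
move=> k0 E; split=> [ab|cd]; apply/eqP; rewrite -subr_eq0.
  by move/eqP: E; rewrite ab subrr eq_sym mulf_eq0 (negPf k0).
by rewrite E cd subrr mulr0.
Qed.

(** Convergent factors are bounded near 0; finitely many of them share a bound, which then controls
    the max norm of the row. *)
Lemma row_eqO {R : realType} {n : nat} (e : R -> R) (f : R -> 'rV[R]_n)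
    (g : 'I_n -> R -> R) :
  (forall j, cvg (g j h @[h --> 0^'+])) ->
  (\forall h \near 0^'+, forall j, f h 0 j = e h * g j h) ->
  f =O_ (0^'+) e.
Proof.
move=> cg fE; apply/eqOP.
have bg : \forall k \near +oo, forall j, \forall h \near 0^'+, `|g j h| <= k.
  by apply: filter_forall => j; exact: (cvg_bounded _ _ (cg j)).
near=> k; have k_ge0 : 0 <= k by near: k; exact: nbhs_pinfty_ge.
have /filter_forall bk : forall j, \forall h \near 0^'+, `|g j h| <= k.
  by near: k.
near=> h; rewrite [leLHS]/Num.Def.normr/= mx_normrE.
rewrite bigmax_le ?mulr_ge0 // => -[i j] _ /=.
have fEh : forall j, f h 0 j = e h * g j h by near: h.
rewrite ord1 fEh normrM mulrC ler_wpM2r //.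
by move: j; near: h.
Unshelve. all: by end_near. Qed.

(** * The explicit integrator and the generating equations *)

(** A row vector meets the leftmost factor first, so each later update reads the coordinates already
    replaced. *)
Definition integrator_mx {R : realType} (A : 'M[R]_3) (dt : R) : 'M[R]_3 :=
  update_mx i3 (\row_i [:: dt * m2 A dt * A i3 i1 / m1 A dt;
                          dt * m2 A dt * A i3 i2 / m1 A dt; (m1 A dt)^-1]`_i)
  *m update_mx i1 (\row_i [:: 1 + dt * A i1 i1; dt * A i1 i2; dt * A i1 i3]`_i)
  *m update_mx i2 (\row_i [:: dt * A i2 i1; 1 + dt * A i2 i2; dt * A i2 i3]`_i).

Lemma mul_integrator_mxP {R : realType} (A : 'M[R]_3) (dt : R)
    (x X : 'rV[R]_3) :
  X = x *m integrator_mx A dt <->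
  [/\ X 0 i3 = (x 0 i3 + dt * m2 A dt * (A i3 i1 * x 0 i1 + A i3 i2 * x 0 i2))
                 / m1 A dt,
      X 0 i1 = (1 + dt * A i1 i1) * x 0 i1 + dt * A i1 i2 * x 0 i2
                 + dt * A i1 i3 * X 0 i3 &
      X 0 i2 = (1 + dt * A i2 i2) * x 0 i2 + dt * A i2 i1 * X 0 i1
                 + dt * A i2 i3 * X 0 i3].
Proof.
rewrite /integrator_mx !mulmxA.
set y := x *m update_mx _ _ *m update_mx _ _ *m _.
have y3 : y 0 i3 = (x 0 i3 + dt * m2 A dt *
    (A i3 i1 * x 0 i1 + A i3 i2 * x 0 i2)) / m1 A dt.
  by rewrite /y !mul_update_mx /= sum_ord3 !mxE /=; ring.
have y1 : y 0 i1 = (1 + dt * A i1 i1) * x 0 i1 + dt * A i1 i2 * x 0 i2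
    + dt * A i1 i3 * y 0 i3.
  by rewrite /y !mul_update_mx /= sum_ord3 !mul_update_mx /= !mxE /=; ring.
have y2 : y 0 i2 = (1 + dt * A i2 i2) * x 0 i2 + dt * A i2 i1 * y 0 i1
    + dt * A i2 i3 * y 0 i3.
  rewrite /y !mul_update_mx /= !sum_ord3 !mul_update_mx /= !sum_ord3.
  by rewrite !mul_update_mx /= !sum_ord3 !mxE /=; ring.
split=> [->//|[X3 X1 X2]].
have e3 : X 0 i3 = y 0 i3 by rewrite X3 y3.
have e1 : X 0 i1 = y 0 i1 by rewrite X1 y1 e3.
by apply: rV3P => //; rewrite X2 y2 e1 e3.
Qed.

(** The two sides differ by [dt] times the trace of [A], up to sign. *)
Lemma m1_factor {R : realType} (A : 'M[R]_3) (dt : R) :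
  A i1 i1 + A i2 i2 + A i3 i3 = 0 ->
  m1 A dt = (1 + dt * A i1 i1) * (1 + dt * A i2 i2).
Proof.
by rewrite addrC => /eqP; rewrite addr_eq0 => /eqP hdiv; rewrite /m1 hdiv; ring.
Qed.

(** The second equation is a nonzero multiple of the update of [X1]. Inserting this [X1] cancels the
    [m1 A dt * A i1 i2] terms of the first equation and the [A i1 i3 * (1 + dt * A i2 i2)] terms of
    the third, leaving the updates of [X3] and [X2]. *)
Lemma S2_equationsP {R : realType} (A : 'M[R]_3) (dt : R) (x X : 'rV[R]_3) :
  A i1 i1 + A i2 i2 + A i3 i3 = 0 -> dt != 0 -> A i1 i2 != 0 -> A i1 i3 != 0 ->
  1 + dt * A i1 i1 != 0 -> 1 + dt * A i2 i2 != 0 ->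
  S2_equations (generating_form A dt) x X <-> X = x *m integrator_mx A dt.
Proof.
move=> hdiv dt0 h12 h13 p0 q0; have m1E := m1_factor A dt hdiv.
have m10 : m1 A dt != 0 by rewrite m1E mulf_neq0.
rewrite mul_integrator_mxP /S2_equations /=.
set x1 := x 0 i1; set x2 := x 0 i2; set x3 := x 0 i3.
set X1 := X 0 i1; set X2 := X 0 i2; set X3 := X 0 i3.
have -> : (fun t => phi A dt x1 X1 t) = fun t =>
    - (m1 A dt * A i1 i2 / (2 * A i1 i3) + dt * A i3 i2 * m2 A dt / 2) * t ^+ 2
    + ((m1 A dt * (X1 - x1 - dt * A i1 i1 * x1)
         - dt ^+ 2 * A i3 i1 * A i1 i3 * m2 A dt * x1) / (dt * A i1 i3)) * t
    + 0.
  by apply/funext => t; rewrite /phi; field; rewrite dt0 h13.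
have -> : (fun t => phi A dt x1 t x2) = fun t => 0 * t ^+ 2
    + m1 A dt * x2 / (dt * A i1 i3) * t + phi A dt x1 0 x2.
  by apply/funext => t; rewrite /phi; field; rewrite dt0 h13.
have -> : (fun t => Phi A dt t X1 X3) = fun t =>
    - (m1 A dt * (1 + dt * A i1 i1) / (2 * dt ^+ 2 * A i1 i2 * A i1 i3))
        * t ^+ 2
    + (m1 A dt * X1 / (dt ^+ 2 * A i1 i2 * A i1 i3)
       - (1 + dt * A i2 i2) * (1 + dt * A i1 i1) * X3 / (dt * A i1 i2)) * t
    + Phi A dt 0 X1 X3.
  by apply/funext => t; rewrite /Phi; field; rewrite dt0 h12 h13.
have -> : (fun t => Phi A dt x1 X1 t) = fun t =>
    (dt * A i2 i3 / 2 - A i1 i3 * (1 + dt * A i2 i2) / (2 * A i1 i2)) * t ^+ 2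
    + ((1 + dt * A i2 i2) * (X1 - (1 + dt * A i1 i1) * x1) / (dt * A i1 i2)
       + dt * A i2 i1 * X1) * t
    + Phi A dt x1 X1 0.
  by apply/funext => t; rewrite /Phi; field; rewrite dt0 h12 h13.
rewrite !derive1_quadratic.
set e2 := (X in [/\ _, X & _]); set X1rhs := (X in [/\ _, X1 = X & _]).
have eq_X1 : e2 <-> X1 = X1rhs.
  (* The scale is the coefficient of [X1] in the second equation; factoring [m1] makes the [X3] term
     a multiple of it too. *)
  apply: (@eq_iff_scale _ (- (m1 A dt / (dt ^+ 2 * A i1 i2 * A i1 i3)))).
    by rewrite oppr_eq0 mulf_neq0 ?invr_eq0 ?mulf_neq0 ?expf_neq0.
  by rewrite m1E /X1rhs; field; rewrite dt0 h12 h13.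
split=> [[e1 /eq_X1 eX1 e3]|[eX3 eX1 eX2]]; split.
- by rewrite e1 eX1 /X1rhs; field; rewrite m10 dt0 h13.
- exact: eX1.
- by rewrite e3 eX1 /X1rhs; field; rewrite dt0 h12.
- by rewrite eX1 /X1rhs eX3; field; rewrite m10 dt0 h13.
- exact/eq_X1.
- by rewrite eX2 eX1 /X1rhs; field; rewrite dt0 h12.
Qed.

(** * Limits as the time step tends to 0, and consistency *)

Lemma cvg_at_right0_id {R : realType} : h @[h --> (0 : R)^'+] --> (0 : R).
Proof. exact: cvg_at_right_filter cvg_id. Qed.

Lemma cvg_inv1D {R : realType} (c : R) :
  (1 + h * c)^-1 @[h --> 0^'+] --> (1 : R).
Proof.
have cvg1D : 1 + h * c @[h --> 0^'+] --> 1 + 0 * c.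
  apply: cvgD; first exact: cvg_cst.
  by apply: cvgM; [exact: cvg_at_right0_id | exact: cvg_cst].
move: cvg1D; rewrite mul0r addr0 => /cvgV -/(_ (oner_neq0 _)).
by rewrite invr1.
Qed.

Lemma near0_1D_neq0 {R : realType} (c : R) :
  \forall h \near (0 : R)^'+, 1 + h * c != 0.
Proof.
(* With the convention that 0 has inverse 0, it suffices that the inverse, which tends to 1, is
   eventually nonzero. *)
near=> h; rewrite -invr_eq0.
by near: h; exact: cvgr_neq0 _ (cvg_inv1D c) (oner_neq0 _).
Unshelve. all: by end_near. Qed.

(** The local error is exactly [dt ^+ 2] times a row of rational functions of [dt] whose
    denominators tend to 1, hence have limits at 0. *)
Lemma integrator_consistent {R : realType} (A : 'M[R]_3) (x : 'rV[R]_3) :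
  A i1 i1 + A i2 i2 + A i3 i3 = 0 ->
  (fun dt : R => x *m integrator_mx A dt - (x + dt *: linear_field A x))
    =O_ (0^'+) (fun dt : R => dt ^+ 2).
Proof.
move=> hdiv.
pose s := A i3 i1 * x 0 i1 + A i3 i2 * x 0 i2.
pose b1 := A i1 i1 * x 0 i1 + A i1 i2 * x 0 i2 + A i1 i3 * x 0 i3.
pose p := A i1 i1 * A i2 i2.
(* dt^2 g_j is the j-th coordinate of the local error. *)
pose g3 (h : R) := (x 0 i3 * (A i3 i3 ^+ 2 - p * (1 + h * A i3 i3))
  + s * (A i3 i3 + h * p * (1 + h * - A i3 i3)^-1 - h * p))
  * (1 + h * A i1 i1)^-1 * (1 + h * A i2 i2)^-1.
(* [d3 h] is the quotient of [X3 - x3] by [h], and [b1 + h * g1 h] that of [X1 - x1]; they enter the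
   later errors because the updates use the new [X3] and [X1]. *)
pose d3 h := s + A i3 i3 * x 0 i3 + h * g3 h.
pose g1 h := A i1 i3 * d3 h.
pose g2 h := A i2 i1 * (b1 + h * g1 h) + A i2 i3 * d3 h.
(* Closure rules in pointwise form, so that convergence of each [g] follows the shape of its
   expression. *)
have cid : cvg (h @[h --> (0 : R)^'+]) := cvgP _ cvg_at_right0_id.
have cinv c : cvg ((1 + h * c)^-1 @[h --> (0 : R)^'+]) := cvgP _ (cvg_inv1D c).
have cc (c : R) : cvg (c @[h --> (0 : R)^'+]) by exact: is_cvg_cst.
have cD (f g : R -> R) : cvg (f h @[h --> 0^'+]) -> cvg (g h @[h --> 0^'+]) ->
  cvg (f h + g h @[h --> 0^'+]) by move=> cf cg; exact: is_cvgD cf cg.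
have cM (f g : R -> R) : cvg (f h @[h --> 0^'+]) -> cvg (g h @[h --> 0^'+]) ->
  cvg (f h * g h @[h --> 0^'+]) by move=> cf cg; exact: is_cvgM cf cg.
have cN (f : R -> R) : cvg (f h @[h --> 0^'+]) -> cvg (- f h @[h --> 0^'+]).
  by move=> cf; exact: is_cvgN cf.
have cg3 : cvg (g3 h @[h --> 0^'+]).
  apply: (cM _ _); last exact: cinv.
  apply: (cM _ _); last exact: cinv.
  apply: (cD _ _); apply: (cM _ _) => //; apply: (cD _ _) => //.
  - apply: (cN _); apply: (cM _ _) => //; apply: (cD _ _) => //.
    exact: (cM _ _).
  - by apply: (cD _ _) => //; do 2!apply: (cM _ _) => //.
  - by apply: (cN _); exact: (cM _ _).
have cd3 : cvg (d3 h @[h --> 0^'+]) by apply: (cD _ _) => //; exact: (cM _ _).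
have cg1 : cvg (g1 h @[h --> 0^'+]) by exact: (cM _ _).
have cg2 : cvg (g2 h @[h --> 0^'+]).
  apply: (cD _ _); apply: (cM _ _) => //; apply: (cD _ _) => //.
  exact: (cM _ _).
apply: (row_eqO _ _ (fun j => [:: g1; g2; g3]`_j)) => [j|].
  by case: (ord3P j) => ->.
near=> h => j.
have p0 : 1 + h * A i1 i1 != 0 by near: h; exact: near0_1D_neq0.
have q0 : 1 + h * A i2 i2 != 0 by near: h; exact: near0_1D_neq0.
have r0 : 1 + h * - A i3 i3 != 0 by near: h; exact: near0_1D_neq0.
have := (mul_integrator_mxP A h x _).1 erefl.
move: (x *m integrator_mx A h) => X [X3 X1 X2].
(* Eliminating [A i3 i3] turns the formula for [X3] into an identity in independent variables. *)
have a33 : A i3 i3 = - (A i1 i1 + A i2 i2).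
  by apply/eqP; rewrite -addr_eq0 addrC hdiv.
have {}X3 : X 0 i3 = x 0 i3 + h * d3 h.
  rewrite X3 (m1_factor A h hdiv) /m2 /d3 /g3 /s /p.
  move: r0; rewrite a33 opprK => r0; field.
  by rewrite p0 q0.
have {}X1 : X 0 i1 = x 0 i1 + h * (b1 + h * g1 h).
  by rewrite X1 X3 /g1 /d3 /b1; ring.
have {}X2 : X 0 i2 = x 0 i2
    + h * (A i2 i1 * x 0 i1 + A i2 i2 * x 0 i2 + A i2 i3 * x 0 i3 + h * g2 h).
  by rewrite X2 X3 X1 /g2; ring.
rewrite !mxE; case: (ord3P j) => -> /=.
- by rewrite X1 /b1; ring.
- by rewrite X2; ring.
- by rewrite X3 /d3 /s; ring.
Unshelve. all: by end_near. Qed.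

Theorem proposition4p2 (R : realType) (A : 'M[R]_3)
    (hdiv : A i1 i1 + A i2 i2 + A i3 i3 = 0)
    (h12 : A i1 i2 != 0) (h13 : A i1 i3 != 0) :
  first_order_volume_preserving_integrator
    (fun dt : R => generating_form A dt) (linear_field A).
Proof.
(* The witness is total in [dt]; values at which a denominator vanishes are excluded by taking [dt]
   small and positive. *)
exists (fun dt x => x *m integrator_mx A dt); split; last first.
  by move=> x; exact: integrator_consistent.
near=> h.
have h0 : h != 0 by rewrite gt_eqF.
have p0 : 1 + h * A i1 i1 != 0 by near: h; exact: near0_1D_neq0.
have q0 : 1 + h * A i2 i2 != 0 by near: h; exact: near0_1D_neq0.
split; first by move=> x X; exact: S2_equationsP.
apply: volume_preserving_mulmx.
rewrite !det_mulmx !det_update_mx !mxE /= (m1_factor A h hdiv).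
by field; rewrite p0 q0.
Unshelve. all: by end_near. Qed.
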